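(* Let $R$ be a nonempty set of red points and $B$ a nonempty set of blue points, all distinct and lying on the line $y=0$, given sorted by $x$-coordinate ($|R|$ and $|B|$ need not be equal). Then a minimum-weight spanning tree of the complete bipartite graph $G(R,B)$, in which the edge $\{r,b\}$ ($r\in R$, $b\in B$) has weight equal to the Euclidean distance $|r-b|$, can be computed in time linear in $|R|+|B|$. *)

(* Defs.v *)
(* Model of computation: a real RAM (unit-cost arithmetic and
   comparisons on reals, indirect addressing), deeply embedded, so that
   "computable in linear time" has a precise meaning. *)
From mathcomp Require Import all_boot all_order all_algebra.
From mathcomp Require Import reals.
Set Implicit Arguments. Unset Strict Implicit. Unset Printing Implicit Defensive.
Import Order.TTheory GRing.Theory Num.Theory.
Local Open Scope ring_scope.

Inductive instr :=
| IConst (d : nat) (c : int)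
| IAdd (a b d : nat)
| ISub (a b d : nat)
| IMul (a b d : nat)
| ILoad (a d : nat)
| IStore (a s : nat)
| IJle (a b t : nat)
| IJmp (t : nat)
| IHalt.

Section RAM.
Variable R : realType.

Definition ram_mem := nat -> R.
Definition addr (x : R) : nat := Num.truncn x.
Definition upd (M : ram_mem) (d : nat) (v : R) : ram_mem :=
  fun k => if k == d then v else M k.

Inductive step_result := Halted of ram_mem | Next of nat & ram_mem.

(* one step of program p from configuration (pc, M); a pc outside the program
   behaves as IHalt *)
Definition step (p : seq instr) (pc : nat) (M : ram_mem) : step_result :=
  match nth IHalt p pc with
  | IConst d c => Next pc.+1 (upd M d (c%:~R))
  | IAdd a b d => Next pc.+1 (upd M d (M a + M b))
  | ISub a b d => Next pc.+1 (upd M d (M a - M b))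
  | IMul a b d => Next pc.+1 (upd M d (M a * M b))
  | ILoad a d => Next pc.+1 (upd M d (M (addr (M a))))
  | IStore a s => Next pc.+1 (upd M (addr (M a)) (M s))
  | IJle a b t => if M a <= M b then Next t M else Next pc.+1 M
  | IJmp t => Next t M
  | IHalt => Halted M
  end.

Fixpoint run (p : seq instr) (k : nat) (pc : nat) (M : ram_mem) : option ram_mem :=
  match k with
  | 0 => None
  | k'.+1 => match step p pc M with
             | Halted M' => Some M'
             | Next pc' M' => run p k' pc' M'
             end
  end.

(* Input layout: M[0] = |R|, M[1] = |B|, M[2..2+|R|-1] = red x-coordinates
   (sorted), M[2+|R| .. 2+|R|+|B|-1] = blue x-coordinates (sorted), 0 elsewhere. *)
Definition init_mem (xr xb : seq R) : ram_mem :=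
  fun k => if k == 0%N then (size xr)%:R
           else if k == 1%N then (size xb)%:R
           else if (k < 2 + size xr)%N then nth 0 xr (k - 2)
           else if (k < 2 + size xr + size xb)%N then nth 0 xb (k - 2 - size xr)
           else 0.

(* Output layout: ptr = addr M[0], count = addr M[1]; edge j is the pair
   (red index addr M[ptr+2j], blue index addr M[ptr+2j+1]) (0-based indices). *)
Definition output_edges (M : ram_mem) : seq (nat * nat) :=
  let ptr := addr (M 0%N) in
  [seq (addr (M (ptr + 2 * j)%N), addr (M (ptr + 2 * j + 1)%N))
  | j <- iota 0 (addr (M 1%N))].

End RAM.

Section Graph.
Variables (m n : nat).
Definition vtx := ('I_m + 'I_n)%type.
Definition edge := ('I_m * 'I_n)%type.

Definition adj (T : {set edge}) : rel vtx := fun u v =>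
  match u, v with
  | inl i, inr j => (i, j) \in T
  | inr j, inl i => (i, j) \in T
  | _, _ => false
  end.

Definition connected_edges (T : {set edge}) : bool :=
  [forall u, forall v, connect (adj T) u v].

(* acyclic: every edge is a bridge (its endpoints are disconnected once it is removed) *)
Definition acyclic_edges (T : {set edge}) : bool :=
  [forall e in T, ~~ connect (adj (T :\ e)) (inl e.1) (inr e.2)].

Definition spanning_tree (T : {set edge}) : bool :=
  connected_edges T && acyclic_edges T.
End Graph.

Section MST.
Variable R : realType.
Variables xr xb : seq R.
Local Notation m := (size xr).
Local Notation n := (size xb).

(* weight of edge {r_i, b_j}: Euclidean distance of points (xr_i,0), (xb_j,0) *)
Definition weight (e : edge m n) : R := `|nth 0 xr e.1 - nth 0 xb e.2|.
Definition tree_weight (T : {set edge m n}) : R := \sum_(e in T) weight e.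

Definition is_MST (T : {set edge m n}) : Prop :=
  spanning_tree T /\
  forall T' : {set edge m n}, spanning_tree T' -> tree_weight T <= tree_weight T'.

Definition describes_MST (s : seq (nat * nat)) : Prop :=
  all (fun e => (e.1 < m)%N && (e.2 < n)%N) s /\ uniq s /\
  is_MST [set e : edge m n | ((e.1 : nat), (e.2 : nat)) \in s].
End MST.

(* Main.v *)
(* Index the edge {r_i, b_j} by the cell (i, j) of the |R| x |B| grid. A minimum
   spanning tree is given by the monotone staircase that starts at (0, 0) and from
   (i, j) moves to the cheaper of (i+1, j) and (i, j+1). Consecutive cells share a
   vertex and every cell but the first brings exactly one new vertex, so the
   staircase is a spanning tree. If (i, j) is off the staircase, the stretch of the
   staircase joining r_i to b_j has all its weights at most |r_i - b_j|: along the
   stretch the signed difference one way is bounded by sortedness, and the other way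
   by the comparison made at the last move that increased it. Hence every edge
   dominates its tree path, which characterises minimum spanning trees by exchange.
   The program first moves the input away from the low addresses, which then
   serve as registers, and follows the staircase with squared distances. *)
Require Import Defs.
From mathcomp Require Import all_boot all_order all_algebra.
From mathcomp Require Import reals zify lra.
Set Implicit Arguments. Unset Strict Implicit. Unset Printing Implicit Defensive.
Import Order.TTheory GRing.Theory Num.Theory.
Local Open Scope ring_scope.

(** * Exchange argument *)

Lemma path_crossing (V : Type) (A : pred V) x p :
    A x -> ~~ A (last x p) ->
  exists p1 y p2, [/\ p = p1 ++ y :: p2, A (last x p1) & ~~ A y].
Proof.
elim: p x => [|y p IH] x Ax /=; first by rewrite Ax.
case: (boolP (A y)) => [Ay|nAy] nA; last by exists [::], y, p.
by have [p1 [z [p2 [-> ? ?]]]] := IH y Ay nA; exists (y :: p1), z, p2.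
Qed.

Section Graph.
Variables m n : nat.
Implicit Types (T S : {set edge m n}) (e f : edge m n) (u v : vtx m n).

Lemma adj_sym T : symmetric (adj T).
Proof. by case=> i [] j. Qed.

Lemma connect_adjC T : connect_sym (adj T).
Proof. exact/sym_connect_sym/adj_sym. Qed.

Lemma adjP T u v : adj T u v ->
  exists2 f, f \in T & (u = inl f.1 /\ v = inr f.2) \/ (u = inr f.2 /\ v = inl f.1).
Proof.
case: u => i; case: v => j //= fT; first by exists (i, j) => //; left.
by exists (j, i) => //; right.
Qed.

Lemma adj_edge T e : e \in T -> adj T (inl e.1) (inr e.2).
Proof. by case: e. Qed.

Lemma connect_edges_sub S T :
    (forall f, f \in S -> connect (adj T) (inl f.1) (inr f.2)) ->
  subrel (connect (adj S)) (connect (adj T)).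
Proof.
move=> ST; apply: connect_sub => u v /adjP [f /ST fT [] [-> ->] //].
by rewrite connect_adjC.
Qed.

Lemma cut_connect T (A : pred (vtx m n)) :
    (forall e, e \in T -> A (inl e.1) = A (inr e.2)) ->
  forall u v, connect (adj T) u v -> A u = A v.
Proof.
move=> TA u v uv; apply: (closed_connect (e := adj T) (a := A)) uv => x y.
by case/adjP=> f /TA fA [] [-> ->].
Qed.

(** A path through [f] visits both its endpoints, so missing one of them keeps it off [f]. *)
Lemma path_avoid T f v x p : (v = inl f.1 \/ v = inr f.2) ->
  v \notin x :: p -> path (adj T) x p -> path (adj (T :\ f)) x p.
Proof.
move=> fv vp; apply: (@sub_in_path _ (predC1 v)); last first.
  by apply/allP => y yp; apply: contraNneq vp => <-.
move=> a b; rewrite !inE => av bv /adjP [g gT gab].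
have gf : g \in T :\ f.
  rewrite in_setD1 gT andbT; apply: contraTneq isT => gf; move: av bv.
  by case: gab => [] [-> ->]; rewrite gf; case: fv => ->; rewrite eqxx.
by case: gab => [] [-> ->]; [|rewrite adj_sym]; apply: adj_edge.
Qed.

(* An edge [e] of [T] missing from [T'] is exchanged for an edge [f] of [T']
   crossing the cut of [T :\ e]; [T'] stays connected, possibly with cycles. *)
Lemma bottleneck_tree_min (R : realType) (w : edge m n -> R) T T' :
    (forall e, 0 <= w e) -> acyclic_edges T ->
    (forall f, connect (adj [set e in T | w e <= w f]) (inl f.1) (inr f.2)) ->
    connected_edges T' ->
  \sum_(e in T) w e <= \sum_(e in T') w e.
Proof.
move=> w0 acT botT; have [k] := ubnP #|T :\: T'|.
elim: k T' => // k IH T' leT cT'.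
have [sTT'|] := boolP (T \subset T').
  rewrite (big_setID (A := T') T) /= (setIidPr sTT') lerDl.
  exact: sumr_ge0.
case/subsetPn=> e eT eT'.
have nA : ~~ connect (adj (T :\ e)) (inl e.1) (inr e.2).
  by have /forallP/(_ e)/implyP/(_ eT) := acT.
have /forallP/(_ (inl e.1))/forallP/(_ (inr e.2))/connectP[p0 pth0 last0] := cT'.
rewrite last0 in nA.
(* On a simple path the part up to [u] misses [v] and the part from [v] misses [u], so neither uses
   [f]. *)
case/shortenP: pth0 last0 nA => p pth un _ last_p nA.
have [p1 [v [p2 [Ep Au nAv]]]] :=
  @path_crossing _ (connect (adj (T :\ e)) (inl e.1)) _ p (connect0 _ _) nA.
move: pth un last_p; rewrite {}Ep -cat_cons cat_uniq cat_path last_cat.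
case/and3P=> pth1 uv pth2 /and3P[_ /norP[vp1 /hasPn vp2] _] last_p.
set u := last _ p1 in Au uv.
have up2 : u \notin v :: p2.
  rewrite inE negb_or; apply/andP; split; first by apply: contraNneq nAv => <-.
  by apply/negP => /vp2; rewrite mem_last.
have [f fT' fuv] := adjP uv.
have fT : f \notin T.
  apply: contra nAv => fT; apply: connect_trans Au (connect1 _).
  have fTe : f \in T :\ e by rewrite in_setD1 fT andbT; apply: contraNneq eT' => <-.
  by case: fuv => [] [-> ->]; [|rewrite adj_sym]; apply: adj_edge.
(* Otherwise the light path given by [botT] for [f] avoids [e] and joins [u] to [v] in [T :\ e]. *)
have wef : w e <= w f.
  rewrite leNgt; apply/negP => wfe; move: nAv; apply/negP; rewrite negbK.
  apply: connect_trans Au _.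
  have cf : connect (adj (T :\ e)) (inl f.1) (inr f.2).
    apply: connect_edges_sub (botT f) => g; rewrite inE => /andP[gT gf].
    apply/connect1/adj_edge; rewrite in_setD1 gT andbT.
    by apply: contraTneq gf => ->; rewrite -ltNge.
  by case: fuv => [] [-> ->] //; rewrite connect_adjC.
set T2 := e |: (T' :\ f).
have sub2 : subrel (connect (adj (T' :\ f))) (connect (adj T2)).
  by apply: connect_edges_sub => g gT; apply/connect1/adj_edge; rewrite in_setU1 gT orbT.
(* [T2] bypasses [f]: back along [p1], across [e], then back along [p2]. *)
have uvT2 : connect (adj T2) u v.
  apply: (@connect_trans _ _ (inl e.1)).
    rewrite connect_adjC; apply/sub2/connectP; exists p1 => //.
    by apply: (@path_avoid _ f v) => //; case: fuv => [] [_ ->]; [right|left].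
  apply: (@connect_trans _ _ (inr e.2)).
    by apply/connect1/adj_edge; rewrite in_setU1 eqxx.
  rewrite connect_adjC; apply/sub2/connectP; exists p2 => //.
  by apply: (@path_avoid _ f u) => //; case: fuv => [] [-> _]; [left|right].
have cT2 : connected_edges T2.
  apply/forallP => x; apply/forallP => y.
  have /forallP/(_ x)/forallP/(_ y) := cT'; apply: connect_edges_sub => g gT'.
  have [->|gf] := eqVneq g f.
    by case: fuv uvT2 => [] [-> ->] //; rewrite connect_adjC.
  by apply/connect1/adj_edge; rewrite in_setU1 in_setD1 gf gT' orbT.
apply: (@le_trans _ _ (\sum_(e in T2) w e)).
  apply: IH cT2; apply: leq_trans (leT : (_ <= k)%N); apply/proper_card/properP; split.
    apply/subsetP => g; rewrite !inE !negb_or negb_and negbK.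
    by case/andP=> /andP[_ /orP[/eqP->|->]] // gT; rewrite gT in fT.
  by exists e; rewrite !inE ?eqxx // eT eT'.
rewrite /T2 big_setU1 /=; last by rewrite in_setD1 (negPf eT') andbF.
by rewrite (big_setD1 f fT') /= lerD2r.
Qed.
End Graph.

(** * Greedy staircases *)

(** Discrete intermediate value principle. *)
Lemma nat_crossing (g : nat -> nat) j N :
  (g 0 <= j < g N)%N -> exists2 k, (k < N)%N & (g k <= j < g k.+1)%N.
Proof.
elim: N => [|N IH] /andP[g0 gN]; first lia.
case: (leqP (g N) j) => gNj; first by exists N; rewrite ?gNj.
by case: IH => [|k kN]; [rewrite g0 | exists k => //; lia].
Qed.

Section Staircase.
Variable R : realType.
Implicit Types (m n : nat) (r b : nat -> R) (row col : nat -> nat).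

Definition increasing_below m r := forall i j, (i < j)%N -> (j < m)%N -> r i < r j.

Lemma increasing_below_le m r i j :
  increasing_below m r -> (i <= j)%N -> (j < m)%N -> r i <= r j.
Proof.
by move=> rP; rewrite leq_eqVlt => /orP[/eqP->//|ij jm]; apply/ltW/rP.
Qed.

(* [k |-> (row k, col k)] is a monotone lattice path from one corner of the
   [m * n] grid of edges to the other which always moves to the cheaper of the
   two next edges. *)
Record greedy_stair m n r b row col : Prop := GreedyStair {
  stair_sum k : (k < (m + n).-1)%N -> (row k + col k)%N = k;
  stair_row k : (k < (m + n).-1)%N -> (row k < m)%N;
  stair_col k : (k < (m + n).-1)%N -> (col k < n)%N;
  stair_move k : (k.+1 < (m + n).-1)%N ->
    [/\ row k.+1 = (row k).+1, col k.+1 = col k &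
        ((col k).+1 < n)%N ->
        `|r (row k).+1 - b (col k)| <= `|r (row k) - b (col k).+1|]
    \/
    [/\ row k.+1 = row k, col k.+1 = (col k).+1 &
        ((row k).+1 < m)%N ->
        `|r (row k) - b (col k).+1| <= `|r (row k).+1 - b (col k)|] }.

(** Exchanging the colours transposes the grid, which reduces one side of the staircase to the
    other. *)
Lemma greedy_stair_swap m n r b row col :
  greedy_stair m n r b row col -> greedy_stair n m b r col row.
Proof.
case=> S1 S2 S3 S4; split; rewrite (addnC n) => // k kN.
  by rewrite addnC S1.
by case: (S4 k kN) => [] [-> -> H]; [right|left]; split=> // /H;
  rewrite !(distrC (b _)).
Qed.

Section Path.
Variables (m n : nat) (r b : nat -> R) (row col : nat -> nat).
Hypothesis rcP : greedy_stair m n r b row col.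
Local Notation N := (m + n).-1.

Lemma stair_mono k l : (k <= l)%N -> (l < N)%N -> (row k <= row l)%N /\ (col k <= col l)%N.
Proof.
move/subnK=> <-; elim: (l - k)%N => // d IH; rewrite addSn => dN.
by have := IH (ltnW dN); case: (stair_move rcP dN) => [] [-> -> _]; lia.
Qed.

Hypotheses (rP : increasing_below m r) (bP : increasing_below n b).

(** The row move was still available and lost the comparison, so the left side is at most
    [|r (row k).+1 - b (col k)|]. *)
Lemma right_move_bound k i j : (k.+1 < N)%N -> (i < m)%N ->
    (j <= col k)%N -> (row k < i)%N -> col k.+1 = (col k).+1 ->
  b (col k.+1) - r (row k.+1) <= r i - b j.
Proof.
move=> kN im jk ki ck.
have colS := stair_col rcP kN.
case: (stair_move rcP kN) => [] [rk ck' w]; first lia.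
rewrite rk ck; rewrite ck in colS.
have ri : r (row k).+1 <= r i by apply: (increasing_below_le rP).
have bj : b j <= b (col k) by apply: (increasing_below_le bP) => //; lia.
have r1 : r (row k) < r (row k).+1 by apply: rP => //; lia.
have b1 : b (col k) < b (col k).+1 by apply: bP.
have {w} := w (leq_ltn_trans ki im).
have := ler_norm (b (col k).+1 - r (row k)); rewrite distrC => n1 n2.
have {n1 n2} := le_trans n1 n2.
(* A nonnegative difference is bounded by sortedness; a negative one would make the comparison
   contradict it. *)
by case: (ger0P (r (row k).+1 - b (col k))) => ? ?; lra.
Qed.

(** When [row (i + j) < i], the staircase leaves column [j] before cell [i + j] and enters row [i]
    after it; the detour lies between. *)
Lemma stair_detour_up i j : (i < m)%N -> (j < n)%N -> (row (i + j) < i)%N ->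
  exists a z, [/\ (a <= z)%N, (z < N)%N, col a = j, row z = i &
    forall l, (a <= l <= z)%N -> `|r (row l) - b (col l)| <= `|r i - b j|].
Proof.
move=> im jn ri.
have ijN : (i + j < N)%N by lia.
have s0 : (row 0 + col 0)%N = 0%N by apply: (stair_sum rcP); lia.
have sij := stair_sum rcP ijN.
have NN : (N.-1 < N)%N by lia.
have sN := stair_sum rcP NN.
have rN := stair_row rcP NN; have cN := stair_col rcP NN.
(* [k0] is the last cell in column [j], [k1.+1] the first in row [i]. *)
have [k0 k0ij /andP[c0 c1]] := @nat_crossing col j (i + j) ltac:(lia).
have [k1 k1N /andP[r0 r1]] := @nat_crossing row i.-1 N.-1 ltac:(lia).
have k0N : (k0.+1 < N)%N by lia.
have {}k1N : (k1.+1 < N)%N by lia.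
have k01 : (i + j <= k1)%N.
  rewrite leqNgt; apply/negP => k1ij.
  by have [] := @stair_mono k1.+1 (i + j) k1ij ijN; lia.
have [rk0 [ck0 ck0S]] : row k0.+1 = row k0 /\ col k0 = j /\ col k0.+1 = j.+1.
  by case: (stair_move rcP k0N) => [] [? ? _]; lia.
have [rk1 [ck1 rk1S]] : row k1.+1 = i /\ col k1.+1 = col k1 /\ row k1 = i.-1.
  by case: (stair_move rcP k1N) => [] [? ? _]; lia.
(* Row moves only lower the left side, column moves fall under [right_move_bound], and the move out
   of [k0] is a column move. *)
have bound l : (k0 < l <= k1)%N -> b (col l) - r (row l) <= r i - b j.
  elim: l => // l IH /andP[k0l lk1].
  have lN : (l.+1 < N)%N by lia.
  have [rl cl] : (row l < i)%N /\ (j <= col l)%N.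
    by have := @stair_mono k0 l; have := @stair_mono l k1; lia.
  case: (stair_move rcP lN) => [] [rlS clS _]; last exact: right_move_bound.
  have {}k0l : (k0 < l)%N.
    by move: k0l; rewrite ltnS leq_eqVlt => /orP[/eqP E|//]; move: ck0 ck0S; rewrite E; lia.
  apply: le_trans (IH _); last lia.
  rewrite clS rlS lerD2l lerN2; apply: (increasing_below_le rP) => //.
  by rewrite -rlS; apply: (stair_row rcP).
exists k0, k1.+1; split=> //; first lia.
move=> l /andP[k0l lk1].
have lN : (l < N)%N by lia.
have [rl cl] : (row l <= i)%N /\ (j <= col l)%N.
  by have := @stair_mono k0 l; have := @stair_mono l k1.+1; lia.
apply: le_trans (ler_norm _); rewrite ler_norml; apply/andP; split; last first.
  by apply: lerB; [apply: (increasing_below_le rP) | apply: (increasing_below_le bP) => //; apply: (stair_col rcP)].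
rewrite lerNl opprB.
(* The two end cells escape [bound]; each follows from its inner neighbour and sortedness. *)
have [/eqP l0|] := boolP (l == k0).
  rewrite l0 ck0; have := bound k0.+1 ltac:(lia); rewrite rk0 ck0S.
  have := @increasing_below_le n b j j.+1 bP (leqnSn _).
  rewrite -ck0S (stair_col rcP k0N) => /(_ isT).
  lra.
have [/eqP l1 _|] := boolP (l == k1.+1).
  rewrite l1 ck1 rk1; have := bound k1 ltac:(lia); rewrite rk1S.
  have := @increasing_below_le m r i.-1 i rP (leq_pred _) im.
  lra.
by move=> *; apply: bound; lia.
Qed.
End Path.

(** The staircase has one cell on the antidiagonal of [(i, j)]; its position relative to row [i]
    selects the case. *)
Lemma stair_detour m n r b row col i j :
    greedy_stair m n r b row col -> increasing_below m r -> increasing_below n b ->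
    (i < m)%N -> (j < n)%N ->
  exists a z, [/\ (a <= z)%N, (z < (m + n).-1)%N,
    (row a = i /\ col z = j) \/ (col a = j /\ row z = i) &
    forall l, (a <= l <= z)%N -> `|r (row l) - b (col l)| <= `|r i - b j|].
Proof.
move=> rcP rP bP im jn.
have sij : (row (i + j) + col (i + j) = i + j)%N by apply: (stair_sum rcP); lia.
case: (ltngtP (row (i + j)%N) i) => ri.
- have [a [z [? ? ? ? ?]]] := stair_detour_up rcP rP bP im jn ri.
  by exists a, z; split=> //; right.
- have cj : (col (j + i) < j)%N by rewrite (addnC j); lia.
  have [a [z [? ? ? ? H]]] := stair_detour_up (greedy_stair_swap rcP) bP rP jn im cj.
  exists a, z; split=> //; [lia|by left|].
  by move=> l /H; rewrite !(distrC (b _)).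
- exists (i + j)%N, (i + j)%N; split=> //; [lia|left; lia|].
  move=> l; rewrite -eqn_leq => /eqP <-.
  by have -> : col (i + j)%N = j by [lia]; rewrite ri.
Qed.

(** * The staircase as a minimum spanning tree *)

Definition stair_edges m n row col : {set edge m n} :=
  [set e : edge m n | ((e.1 : nat), (e.2 : nat)) \in
                      [seq (row k, col k) | k <- iota 0 (m + n).-1]].

Lemma stair_edgesP m n row col (e : edge m n) :
  reflect (exists2 k, (k < (m + n).-1)%N & e.1 = row k :> nat /\ e.2 = col k :> nat)
          (e \in stair_edges m n row col).
Proof.
rewrite inE; apply: (iffP mapP) => [[k]|[k kN [e1 e2]]].
  by rewrite mem_iota => kN [-> ->]; exists k.
by exists k; rewrite ?mem_iota ?e1 ?e2.
Qed.

(** Consecutive cells share a vertex, so induction along the stretch links everything to [row a]. *)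
Lemma stair_segment_connect m n r b row col (S : {set edge m n}) a z :
    greedy_stair m n r b row col -> (a <= z < (m + n).-1)%N ->
    (forall (e : edge m n) l, (a <= l <= z)%N ->
       e.1 = row l :> nat -> e.2 = col l :> nat -> e \in S) ->
  forall (i : 'I_m) (j : 'I_n), (i = row a :> nat /\ j = col z :> nat) \/
    (j = col a :> nat /\ i = row z :> nat) -> connect (adj S) (inl i) (inr j).
Proof.
move=> rcP /andP[az zN] inS.
have aN : (a < (m + n).-1)%N by lia.
have edgeS l (i : 'I_m) (j : 'I_n) : (a <= l <= z)%N -> i = row l :> nat ->
    j = col l :> nat -> connect (adj S) (inl i) (inr j).
  by move=> lz il jl; apply/connect1/(@adj_edge _ _ _ (i, j))/(inS (i, j) l).
pose i0 := Ordinal (stair_row rcP aN); pose j0 := Ordinal (stair_col rcP aN).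
have reach l (i : 'I_m) (j : 'I_n) : (a <= l <= z)%N -> i = row l :> nat ->
    j = col l :> nat -> connect (adj S) (inl i0) (inl i) /\ connect (adj S) (inl i0) (inr j).
  elim: l i j => [|l IH] i j lz il jl.
    have -> : i = i0 by apply: val_inj => /=; rewrite il; congr row; lia.
    by split=> //; apply: (edgeS 0%N) => //=; congr row; lia.
  have [/eqP al|al] := boolP (a == l.+1).
    have -> : i = i0 by apply: val_inj; rewrite /= il al.
    by split=> //; apply: (edgeS l.+1) => //=; rewrite al.
  have lN : (l.+1 < (m + n).-1)%N by lia.
  have lz' : (a <= l <= z)%N by lia.
  have ij := edgeS _ _ _ lz il jl.
  case: (stair_move rcP lN) => [] [rl cl _].
    have rl' := stair_row rcP (ltnW lN).
    have [_ cj] := IH (Ordinal rl') j lz' erefl (etrans jl cl).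
    by split=> //; apply: connect_trans cj _; rewrite connect_adjC.
  have cl' := stair_col rcP (ltnW lN).
  have [ci _] := IH i (Ordinal cl') lz' (etrans il rl) erefl.
  by split=> //; apply: connect_trans ci _.
move=> i j [[ia jz]|[ja iz]].
  have -> : i = i0 by exact: val_inj.
  by have [] := reach z (Ordinal (stair_row rcP zN)) j ltac:(lia) erefl jz.
have [+ _] := reach z i (Ordinal (stair_col rcP zN)) ltac:(lia) iz erefl.
rewrite connect_adjC => /connect_trans; apply.
by apply: (edgeS a) => //; lia.
Qed.

(** Each edge is a bridge: some vertex set is crossed by it alone. *)
Lemma stair_acyclic m n r b row col :
  greedy_stair m n r b row col -> acyclic_edges (stair_edges m n row col).
Proof.
move=> rcP; apply/forallP => e; apply/implyP => /stair_edgesP [k kN [e1 e2]].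
pose cut_off (A : pred (vtx m n)) := A (inl e.1) != A (inr e.2) /\
  forall (f : edge m n) l, (l < (m + n).-1)%N -> l != k ->
    f.1 = row l :> nat -> f.2 = col l :> nat -> A (inl f.1) = A (inr f.2).
suff [A [Ae TA]] : exists A, cut_off A.
  apply: contra Ae => /(cut_connect _)-> // f; rewrite in_setD1 => /andP[fe].
  case/stair_edgesP=> l lN [f1 f2]; apply: (TA f l) => //.
  apply: contraNneq fe => lk; rewrite -lk in e1 e2.
  by apply/eqP/injective_projections; apply: val_inj; rewrite /= ?f1 ?f2.
have kP := stair_sum rcP kN.
have mono l : (l < (m + n).-1)%N -> [/\ (row l + col l = l)%N,
    (k <= l)%N -> (row k <= row l)%N /\ (col k <= col l)%N &
    (l <= k)%N -> (row l <= row k)%N /\ (col l <= col k)%N].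
  move=> lN; split; first exact: (stair_sum rcP lN).
  - by move=> kl; apply: (stair_mono rcP).
  - by move=> lk; apply: (stair_mono rcP).
(* Removing cell [k] splits the staircase into the cells before and after it.
   The cut separates the vertex of [e] that is new at [k], together with all
   later vertices unless the other endpoint of [e] is shared with cell [k.+1]. *)
have rowcut : (forall l, (l < k)%N -> (row l < row k)%N) -> exists A, cut_off A.
  move=> rk; have [/andP[kS /eqP rS]|nS] := boolP ((k.+1 < (m + n).-1)%N && (row k.+1 == row k)).
    exists (fun v : vtx m n => match v with inl i => (e.1 <= i)%N | inr j => (e.2 < j)%N end).
    split=> [|f l lN lk f1 f2]; first by rewrite leqnn ltnn.
    have [ls up dn] := mono l lN; rewrite e1 e2 f1 f2.
    have [Sk _ _] := mono _ kS.
    case: (ltngtP l k) lk => // lk _; first by have := rk l lk; lia.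
    by have [] := stair_mono rcP lk lN; lia.
  exists (fun v : vtx m n => if v is inl i then i == e.1 else false).
  split=> [|f l lN lk f1 f2]; first by rewrite eqxx.
  apply/negbTE; rewrite -val_eqE /= e1 f1.
  case: (ltngtP l k) lk => // lk _; first by have := rk l lk; lia.
  have kS : (k.+1 < (m + n).-1)%N by lia.
  have [] := stair_mono rcP lk lN; case: (stair_move rcP kS) => [] [? ? _]; lia.
have colcut : (forall l, (l < k)%N -> (col l < col k)%N) -> exists A, cut_off A.
  move=> rk; have [/andP[kS /eqP rS]|nS] := boolP ((k.+1 < (m + n).-1)%N && (col k.+1 == col k)).
    exists (fun v : vtx m n => match v with inl i => (e.1 < i)%N | inr j => (e.2 <= j)%N end).
    split=> [|f l lN lk f1 f2]; first by rewrite leqnn ltnn.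
    have [ls up dn] := mono l lN; rewrite e1 e2 f1 f2.
    have [Sk _ _] := mono _ kS.
    case: (ltngtP l k) lk => // lk _; first by have := rk l lk; lia.
    by have [] := stair_mono rcP lk lN; lia.
  exists (fun v : vtx m n => if v is inr j then j == e.2 else false).
  split=> [|f l lN lk f1 f2]; first by rewrite eqxx.
  apply/esym/negbTE; rewrite -val_eqE /= e2 f2.
  case: (ltngtP l k) lk => // lk _; first by have := rk l lk; lia.
  have kS : (k.+1 < (m + n).-1)%N by lia.
  have [] := stair_mono rcP lk lN; case: (stair_move rcP kS) => [] [? ? _]; lia.
(* The move into [k] tells which vertex is new; at [k = 0] both are. *)
have [k0|k0] := posnP k; first by apply: rowcut => l; rewrite k0.
have kN' : (k.-1.+1 < (m + n).-1)%N by rewrite prednK.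
case: (stair_move rcP kN'); rewrite prednK // => -[rk ck _];
  [apply: rowcut|apply: colcut] => l lk;
  by have [] := @stair_mono _ _ _ _ _ _ rcP l k.-1 ltac:(lia) ltac:(lia); lia.
Qed.

(** The detours give connectedness and the bottleneck condition of the exchange argument at once. *)
Lemma stair_MST (xr xb : seq R) row col :
    (0 < size xr)%N -> (0 < size xb)%N -> sorted <%R xr -> sorted <%R xb ->
    greedy_stair (size xr) (size xb) (nth 0 xr) (nth 0 xb) row col ->
  is_MST (stair_edges (size xr) (size xb) row col).
Proof.
move=> m0 n0 sr sb rcP.
have incr (s : seq R) : sorted <%R s -> increasing_below (size s) (nth 0 s).
  by move=> ss i j ij js; apply: (sorted_ltn_nth lt_trans) => //; apply: ltn_trans js.
set T := stair_edges _ _ _ _.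
have bot (f : edge (size xr) (size xb)) :
    connect (adj [set e in T | weight e <= weight f]) (inl f.1) (inr f.2).
  have [a [z [az zN ends bd]]] :=
    stair_detour rcP (incr _ sr) (incr _ sb) (ltn_ord f.1) (ltn_ord f.2).
  apply: (@stair_segment_connect _ _ _ _ _ _ _ a z rcP); first lia; last first.
    by case: ends => [] [-> ->]; [left|right].
  move=> e l lz e1 e2; rewrite inE; apply/andP; split.
    by apply/stair_edgesP; exists l => //; lia.
  by rewrite /weight e1 e2; apply: bd.
have acT : acyclic_edges T by apply: stair_acyclic rcP.
split=> [|T' /andP[cT' _]]; last first.
  by apply: bottleneck_tree_min cT' => // e; apply: normr_ge0.
apply/andP; split=> //.
have LR i j : connect (adj T) (inl i) (inr j).
  apply: connect_edges_sub (bot (i, j)) => f; rewrite inE => /andP[fT _].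
  exact/connect1/adj_edge.
apply/forallP=> -[] i; apply/forallP=> -[] j //.
- by apply: (connect_trans (LR i (Ordinal n0))); rewrite connect_adjC.
- by rewrite connect_adjC.
- by apply: (connect_trans _ (LR (Ordinal m0) j)); rewrite connect_adjC.
Qed.
End Staircase.

(** * Existence of a greedy staircase *)

Section GreedyPath.
Variable R : realType.
Variables (m n : nat) (r b : nat -> R).

Definition greedy_next (c : nat * nat) : nat * nat :=
  if (c.1.+1 < m)%N &&
     ((n <= c.2.+1)%N || (`|r c.1.+1 - b c.2| <= `|r c.1 - b c.2.+1|))
  then (c.1.+1, c.2) else (c.1, c.2.+1).

Definition greedy_cell k := iter k greedy_next (0, 0)%N.

Lemma greedy_cellS k : greedy_cell k.+1 = greedy_next (greedy_cell k).
Proof. by []. Qed.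

Lemma greedy_cellP : (0 < m)%N -> (0 < n)%N ->
  greedy_stair m n r b (fun k => (greedy_cell k).1) (fun k => (greedy_cell k).2).
Proof.
move=> m0 n0.
have bd k : (k < (m + n).-1)%N -> [/\ ((greedy_cell k).1 + (greedy_cell k).2)%N = k,
    ((greedy_cell k).1 < m)%N & ((greedy_cell k).2 < n)%N].
  elim: k => [|k IH] kN; first by split.
  have [] := IH (ltnW kN); rewrite greedy_cellS /greedy_next.
  by case: ifP => /= [/andP[im _]|/negbT/nandP[|/norP[]]] *; split=> //; lia.
split=> k kN; try by have [] := bd k kN.
rewrite greedy_cellS /greedy_next; have [_ lm ln] := bd _ kN.
case: ifP => /= [/andP[_ /orP[|w]]|/negbT]; [|by left|].
- by left; split=> // ?; lia.
- rewrite negb_and negb_or => /orP[w|/andP[_ w]]; right; split=> //.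
  + by rewrite (negPf w).
  + by move=> _; apply: ltW; rewrite ltNge.
Qed.
End GreedyPath.

(** * Real-RAM program *)

Section Exec.
Variables (R : realType) (p : seq instr).
Implicit Types (M : ram_mem R) (Q : nat -> ram_mem R -> Prop).

(** [run] yields nothing before halting, so progress is expressed for every remaining fuel [k]; the
    bound [t] is shared by branches of different lengths. *)
Definition reach t pc M Q := exists t' pc' M',
  [/\ (t' <= t)%N, forall k, run p (t' + k) pc M = run p k pc' M' & Q pc' M'].

Lemma reach_refl t pc M Q : Q pc M -> reach t pc M Q.
Proof. by exists 0%N, pc, M; split. Qed.

Lemma reach_step t pc M pc1 M1 Q :
  step p pc M = Next pc1 M1 -> reach t pc1 M1 Q -> reach t.+1 pc M Q.
Proof.
move=> st [t' [pc' [M' [tt rn q]]]]; exists t'.+1, pc', M'; split=> // k.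
by rewrite addSn /= st rn.
Qed.

Lemma reach_trans t1 t2 pc M Q1 Q : reach t1 pc M Q1 ->
  (forall pc' M', Q1 pc' M' -> reach t2 pc' M' Q) -> reach (t1 + t2) pc M Q.
Proof.
move=> [t' [pc' [M' [tt rn /[swap] /[apply]]]]].
move=> [t2' [pc2 [M2 [tt2 rn2 q]]]]; exists (t' + t2')%N, pc2, M2; split=> //.
  by lia.
by move=> k; rewrite -addnA rn rn2.
Qed.

Lemma reach_halt t pc M Q : reach t pc M Q ->
    (forall pc' M', Q pc' M' -> nth IHalt p pc' = IHalt) ->
  exists M', run p t.+1 pc M = Some M' /\ exists pc', Q pc' M'.
Proof.
move=> [t' [pc' [M' [tt rn q]]]] hlt; exists M'; split; last by exists pc'.
have -> : t.+1 = (t' + (t - t').+1)%N by lia.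
by rewrite rn /= /step (hlt _ _ q).
Qed.

Lemma run_mono k k' pc M M' : (k <= k')%N -> run p k pc M = Some M' ->
  run p k' pc M = Some M'.
Proof.
elim: k k' pc M => [|k IH] [|k'] //= pc M kk.
by case: step => // pc1 M1; apply: IH.
Qed.
End Exec.

Lemma addr_nat (R : realType) k : addr (k%:R : R) = k.
Proof. exact: natrK. Qed.

(* Numbers in comments are the addresses of jump targets. With [s = |R| + |B|] and
   [D = |B| + 7 s], which is beyond both the input and the registers 0..14, input
   cell [k] is copied to [D + k]: in a straight line for [k <= 14], where only
   cells 0 and 1 are free to compute with, and in a loop from 43 for the others.
   Adding [s] to the pointer rather than scaling it keeps [|B|] recoverable without
   division. In the main loop from 68 the registers hold: 0, 1 the output pointer
   and count, 2, 3 the current cell [(i, j)], 4 the write pointer, 5, 6 the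
   addresses of the first red and blue points, 7, 8 the last indices [|R| - 1] and
   [|B| - 1], 9 the constant 1. *)
Definition mst_program : seq instr :=
  IAdd 0 1 0 :: nseq 7 (IAdd 0 1 1) ++ [:: IStore 1 0; IConst 0 (Posz 1); IAdd 1 0 1] ++
  flatten [seq [:: IAdd 1 0 1; IStore 1 j] | j <- iota 2 13] ++
  [:: IConst 2 (Posz 14); ISub 1 2 1; ILoad 1 3; IConst 4 (Posz 15); IConst 5 (Posz 2); IAdd 3 5 5;
      (* 43 *) IJle 5 4 49; ILoad 4 6; IAdd 1 4 7; IStore 7 6; IAdd 4 0 4; IJmp 43] ++
  (* 49 *) ISub 1 3 8 :: nseq 6 (ISub 8 3 8) ++
  [:: IConst 9 (Posz 1); IConst 10 (Posz 2); IAdd 1 10 5; ISub 3 8 7; IAdd 5 7 6; IAdd 5 3 0;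
      IAdd 5 3 4; ISub 8 9 8; ISub 7 9 7; ISub 3 9 1; IConst 2 (Posz 0); IConst 3 (Posz 0);
      (* 68 *) IStore 4 2; IAdd 4 9 4; IStore 4 3; IAdd 4 9 4;
      IJle 7 2 91; IJle 8 3 89;
      IAdd 5 2 10; ILoad 10 11; IAdd 10 9 10; ILoad 10 12;
      IAdd 6 3 10; ILoad 10 13; IAdd 10 9 10; ILoad 10 14;
      ISub 12 13 12; IMul 12 12 12; ISub 11 14 11; IMul 11 11 11; IJle 12 11 89;
      (* 87 *) IAdd 3 9 3; IJmp 68;
      (* 89 *) IAdd 2 9 2; IJmp 68;
      (* 91 *) IJle 8 3 93; IJmp 87; IHalt].

Lemma ler_sqr_abs (R : realDomainType) (x y : R) : (x ^+ 2 <= y ^+ 2) = (`|x| <= `|y|).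
Proof. by rewrite -(real_normK (num_real x)) -(real_normK (num_real y)) ler_sqr ?nnegrE. Qed.

(** * Relocation of the input *)

Section Program.
Variables (R : realType) (xr xb : seq R).
Local Notation m := (size xr).
Local Notation n := (size xb).
Local Notation s := (m + n)%N.
Local Notation p := mst_program.
Local Notation I0 := (init_mem xr xb).
Implicit Types M : ram_mem R.
Hypotheses (m_gt0 : (0 < m)%N) (n_gt0 : (0 < n)%N).

Definition base := (n + 7 * s)%N.
Local Notation D := base.

(** Nonemptiness gives [n >= 1] and [s >= 2], whence [n + 7 * s >= 15]. *)
Lemma base_ge : (15 <= D)%N /\ (s + 2 <= D)%N.
Proof. by rewrite /base; lia. Qed.

Arguments upd _ _ _ _ _ /.

(** Invariant of the straight-line copy; [s] is parked at [D] until registers become free. *)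
Record saved j M : Prop := Saved {
  saved0 : M 0%N = 1%:R;
  saved1 : M 1%N = (D + j)%:R;
  savedD : M D = s%:R;
  saved_old k : (j < k < s + 2)%N -> M k = I0 k;
  saved_new k : (2 <= k <= j)%N -> (k < s + 2)%N -> M (D + k)%N = I0 k }.

Ltac exec := apply: reach_step; [reflexivity|]; rewrite /=.
Ltac look := repeat match goal with |- context [if ?a == ?b then _ else _] =>
  case: (a =P b) => ?; try (exfalso; lia) end.

Lemma const_nat k : (Posz k)%:~R = k%:R :> R.
Proof. by []. Qed.

Lemma start_saved : reach p 11 0 I0 (fun pc M => pc = 11 /\ saved 1 M).
Proof.
have [D15 Ds] := base_ge.
have M0 : I0 0%N = m%:R by [].
have M1 : I0 1%N = n%:R by [].
do 8 exec; rewrite M0 M1 -!natrD.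
exec; rewrite addr_nat.
have -> : (s + (s + (s + (s + (s + (s + (s + n)))))))%N = D by rewrite /base; lia.
do 2 exec; look; rewrite ?const_nat.
apply: reach_refl; split=> //; split=> [||| k kj | k kj ks] /=; look => //.
by rewrite -natrD.
Qed.

Lemma save_next j : (0 < j < 14)%N -> forall M, saved j M ->
  reach p 2 (9 + 2 * j) M (fun pc M => pc = (9 + 2 * j.+1)%N /\ saved j.+1 M).
Proof.
move=> jlt M [M0 M1 MD old new]; have [D15 Ds] := base_ge.
have st0 : nth IHalt p (9 + 2 * j) = IAdd 1 0 1.
  by case: j jlt {M1 old new} => //; do 13 case=> //.
have st1 : nth IHalt p (9 + 2 * j).+1 = IStore 1 j.+1.
  by case: j jlt {M1 old new st0} => //; do 13 case=> //.
apply: reach_step; first by rewrite /step st0.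
apply: reach_step; first by rewrite /step st1 /= M0 M1 -natrD addr_nat.
apply: reach_refl; split; first by lia.
split=> [||| k kj | k kj ks] /=; look => //.
- by rewrite -addnA addn1.
- by apply: old; lia.
- have -> : k = j.+1 by lia.
  by apply: old; lia.
- by apply: new; lia.
Qed.

Lemma all_saved : reach p 37 0 I0 (fun pc M => pc = 37 /\ saved 14 M).
Proof.
have H j : (j < 14)%N -> reach p (11 + 2 * j) 0 I0
    (fun pc M => pc = (11 + 2 * j)%N /\ saved j.+1 M).
  elim: j => [|j IH] j14; first exact: start_saved.
  have -> : (11 + 2 * j.+1 = (11 + 2 * j) + 2)%N by lia.
  apply: reach_trans (IH _) _; first lia.
  move=> pc M [-> sv]; have := @save_next j.+1 ltac:(lia) M sv.
  have -> : (9 + 2 * j.+1 = 11 + 2 * j)%N by lia.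
  by have -> : (9 + 2 * j.+2 = 11 + 2 * j + 2)%N by lia.
exact: (H 13).
Qed.

(** Invariant of the copy loop, with [c] the next cell to copy. *)
Record copied c M : Prop := Copied {
  copied0 : M 0%N = 1%:R;
  copied1 : M 1%N = D%:R;
  copied3 : M 3%N = s%:R;
  copied4 : M 4%N = c%:R;
  copied5 : M 5%N = (s + 2)%:R;
  copied_old k : (14 < k < s + 2)%N -> M k = I0 k;
  copied_new k : (2 <= k < c)%N -> (k < s + 2)%N -> M (D + k)%N = I0 k }.

Lemma start_copied M : saved 14 M ->
  reach p 6 37 M (fun pc M => pc = 43 /\ copied 15 M).
Proof.
move=> [M0 M1 MD old new]; have [D15 Ds] := base_ge.
do 3 exec; rewrite M1 const_nat natrD addrK addr_nat; look; rewrite MD.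
do 3 exec; rewrite !const_nat -natrD.
by apply: reach_refl; split=> //; split=> [|||||k kj|k kj ks] //=; look => //; [apply: old | apply: new].
Qed.

Lemma copy_next c M : (14 < c < s + 2)%N -> copied c M ->
  reach p 6 43 M (fun pc M => pc = 43 /\ copied c.+1 M).
Proof.
move=> cs [M0 M1 M3 M4 M5 old new]; have [D15 Ds] := base_ge.
apply: reach_step; first by rewrite /step /= M4 M5 ler_nat leqNgt; case: ltnP => //; lia.
do 3 exec; rewrite M1 M4 -natrD !addr_nat.
do 2 exec; look; rewrite M0 M4 -natrD.
apply: reach_refl; split=> //; split=> [|||||k kj|k kc ks] //=; look => //.
- by rewrite addn1.
- exact: old.
- by rewrite -old; [congr M|]; lia.
- by apply: new; lia.
Qed.

(** Short inputs exit the loop at once with [c = 15], so the final [c] may exceed [s + 2]. *)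
Lemma copy_all M : saved 14 M -> reach p (7 + 6 * s) 37 M
  (fun pc M => pc = 49 /\ exists2 c, (s + 2 <= c)%N & copied c M).
Proof.
move=> sv; apply: (@reach_trans _ _ 6 (1 + 6 * s)) (start_copied sv) _ => _ {sv}M [-> cp].
have exit_loop t c M' : (s + 2 <= c)%N -> copied c M' ->
    reach p t.+1 43 M' (fun pc M => pc = 49 /\ exists2 c, (s + 2 <= c)%N & copied c M).
  move=> cs cM'; apply: reach_step.
    by case: cM' => _ _ _ M4 M5 _ _; rewrite /step /= M4 M5 ler_nat cs.
  by apply: reach_refl; split=> //; exists c.
have H d : forall c M', (14 < c)%N -> (s + 2 <= c + d)%N -> copied c M' ->
    reach p (1 + 6 * d) 43 M' (fun pc M => pc = 49 /\ exists2 c, (s + 2 <= c)%N & copied c M).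
  elim: d => [|d IH] c M' c14 cd cM'.
    by apply: (exit_loop _ c) => //; lia.
  case: (ltnP c (s + 2)) => cs; last exact: (exit_loop _ c).
  have -> : (1 + 6 * d.+1 = 6 + (1 + 6 * d))%N by lia.
  apply: reach_trans (copy_next _ cM') _; first lia.
  by move=> _ M1 [-> ?]; apply: (IH c.+1) => //; lia.
by apply: (H s 15) => //; lia.
Qed.

(** * Main loop *)

Local Notation out0 := (D + 2 + s)%N.
Local Notation cell := (greedy_cell m n (nth 0 xr) (nth 0 xb)).

(* The memory in which the first [k] edges have been written and [c] is the
   current edge. *)
Record looping k (c : nat * nat) M : Prop := Looping {
  looping0 : M 0%N = out0%:R;
  looping1 : M 1%N = s.-1%:R;
  looping2 : M 2%N = c.1%:R;
  looping3 : M 3%N = c.2%:R;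
  looping4 : M 4%N = (out0 + 2 * k)%:R;
  looping5 : M 5%N = (D + 2)%:R;
  looping6 : M 6%N = (D + 2 + m)%:R;
  looping7 : M 7%N = m.-1%:R;
  looping8 : M 8%N = n.-1%:R;
  looping9 : M 9%N = 1%:R;
  looping_red i : (i < m)%N -> M (D + 2 + i)%N = nth 0 xr i;
  looping_blue j : (j < n)%N -> M (D + 2 + m + j)%N = nth 0 xb j;
  looping_out l : (l < k)%N -> M (out0 + 2 * l)%N = (cell l).1%:R /\
                               M (out0 + 2 * l + 1)%N = (cell l).2%:R }.

Lemma start_looping c M : (s + 2 <= c)%N -> copied c M ->
  reach p 19 49 M (fun pc M => pc = 68 /\ looping 0 (cell 0) M).
Proof.
move=> cs [M0 M1 M3 M4 M5 old new]; have [D15 Ds] := base_ge.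
have natB (x y : nat) : (y <= x)%N -> x%:R - y%:R = (x - y)%:R :> R by move/natrB->.
do 7 exec; rewrite M1 M3.
have -> : D%:R - s%:R - s%:R - s%:R - s%:R - s%:R - s%:R - s%:R = n%:R :> R.
  by rewrite /base natrD natrM; lra.
do 12 exec; rewrite M1 M3 !const_nat.
apply: reach_refl; split=> //; split=> [||||||||||i im|j jn|//] //=; look.
- by rewrite -!natrD.
- by rewrite natB ?subn1 //; lia.
- by rewrite muln0 addn0 -!natrD.
- by rewrite -natrD.
- by rewrite natB ?addnK -?natrD //; lia.
- by rewrite natB ?addnK ?natB ?subn1 //; lia.
- by rewrite natB ?subn1 //; lia.
- rewrite -addnA new; [|lia|lia].
  rewrite /init_mem; have -> : (2 + i == 0)%N = false by lia.
  have -> : (2 + i == 1)%N = false by lia.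
  by have -> : (2 + i < 2 + m)%N by [lia]; congr nth; lia.
- have -> : (D + 2 + m + j = D + (2 + m + j))%N by lia.
  rewrite new; [|lia|lia].
  rewrite /init_mem; have -> : (2 + m + j == 0)%N = false by lia.
  have -> : (2 + m + j == 1)%N = false by lia.
  have -> : (2 + m + j < 2 + m)%N = false by lia.
  by have -> : (2 + m + j < 2 + m + n)%N by [lia]; congr nth; lia.
Qed.

Lemma write_edge k M : looping k (cell k) M ->
  reach p 4 68 M (fun pc M => pc = 72 /\ looping k.+1 (cell k) M).
Proof.
move=> [M0 M1 M2 M3 M4 M5 M6 M7 M8 M9 red blue out]; have [D15 Ds] := base_ge.
exec; rewrite M4 addr_nat M2; exec; look; rewrite M4 M9 -natrD.
exec; rewrite addr_nat; look; rewrite M3; exec; look; rewrite M9 -natrD.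
apply: reach_refl; split=> //; split=> [||||||||||i im|j jn|l lk]; last first.
  have [->|lk'] : l = k \/ (l < k)%N by lia.
    by split=> /=; look.
  by have [o1 o2] := out l lk'; split=> /=; look.
all: rewrite /=; look => //.
- exact: blue.
- exact: red.
- by congr (_%:R); lia.
Qed.

(** Choosing the next cell writes only to registers 2, 3 and the scratch registers 10 to 14. *)
Lemma looping_move k c c' M M' : looping k c M ->
    (forall x, ((x < 2) || (3 < x < 10) || (14 < x))%N -> M' x = M x) ->
    M' 2%N = c'.1%:R -> M' 3%N = c'.2%:R -> looping k c' M'.
Proof.
move=> [M0 M1 _ _ M4 M5 M6 M7 M8 M9 red blue out] eqM M2 M3; have [D15 Ds] := base_ge.
split=> // [||||||||i im|j jn|l lk]; rewrite ?eqM //; try lia; [exact: red|exact: blue|exact: out].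
Qed.

Lemma next_edge k M : (k.+1 < s.-1)%N -> looping k.+1 (cell k) M ->
  reach p 17 72 M (fun pc M => pc = 68 /\ looping k.+1 (cell k.+1) M).
Proof.
move=> kN lM; case: (lM) => M0 M1 M2 M3 M4 M5 M6 M7 M8 M9 red blue out.
have [D15 Ds] := base_ge.
have gP := greedy_cellP (nth 0 xr) (nth 0 xb) m_gt0 n_gt0.
have sumk := stair_sum gP (ltnW kN).
have rowk := stair_row gP (ltnW kN).
have colk := stair_col gP (ltnW kN).
rewrite greedy_cellS /greedy_next; move: (cell k) M2 M3 sumk rowk colk => [i j] /=.
move=> M2 M3 sumk rowk colk.
have goRow pc' : pc' = (if (m.-1 <= i)%N then 91 else 73)%N -> step p 72 M = Next pc' M.
  by move=> ->; rewrite /step /= M7 M2 ler_nat; case: leqP.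
have goCol pc pc' pc2 : nth IHalt p pc = IJle 8 3 pc2 ->
    pc' = (if (n.-1 <= j)%N then pc2 else pc.+1)%N -> step p pc M = Next pc' M.
  by move=> pcE ->; rewrite /step pcE M8 M3 ler_nat; case: leqP.
apply: reach_step (goRow _ erefl) _.
case: (leqP m.-1 i) => im.
  have -> : (i.+1 < m)%N = false by lia.
  apply: reach_step (goCol 91%N _ _ erefl erefl) _.
  (* The cell is not the far corner, so in the last row a column move remains. *)
  have -> : (n.-1 <= j)%N = false by lia.
  do 3 exec; rewrite M3 M9 -natrD addn1.
  by apply: reach_refl; split=> //; apply: (looping_move lM) => // x xP /=; look.
have -> : (i.+1 < m)%N by lia.
apply: reach_step (goCol 73%N _ _ erefl erefl) _.
have -> : (n.-1 <= j)%N = (n <= j.+1)%N by lia.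
case: (leqP n j.+1) => jn /=.
  do 2 exec; rewrite M2 M9 -natrD addn1.
  by apply: reach_refl; split=> //; apply: (looping_move lM) => // x xP /=; look.
do 12 exec; rewrite M5 M2 M6 M3 M9 -!natrD !addr_nat; look.
have -> : (D + 2 + i + 1 = D + 2 + i.+1)%N by lia.
have -> : (D + 2 + m + j + 1 = D + 2 + m + j.+1)%N by lia.
rewrite !red ?blue //; last lia.
case: ifP => w.
  apply: reach_step; first by rewrite /step /= -!expr2 ler_sqr_abs w; reflexivity.
  do 2 exec; rewrite M2 M9 -natrD addn1.
  by apply: reach_refl; split=> //; apply: (looping_move lM) => // x xP /=; look.
apply: reach_step; first by rewrite /step /= -!expr2 ler_sqr_abs w; reflexivity.
do 2 exec; rewrite M3 M9 -natrD addn1.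
by apply: reach_refl; split=> //; apply: (looping_move lM) => // x xP /=; look.
Qed.

Lemma last_edge k M : k.+1 = s.-1 -> looping k.+1 (cell k) M ->
  reach p 2 72 M (fun pc M => pc = 93 /\ looping k.+1 (cell k) M).
Proof.
move=> kN lM; case: (lM) => M0 M1 M2 M3 M4 M5 M6 M7 M8 M9 red blue out.
have gP := greedy_cellP (nth 0 xr) (nth 0 xb) m_gt0 n_gt0.
have kN' : (k < s.-1)%N by rewrite -kN.
have sumk := stair_sum gP kN'.
have rowk := stair_row gP kN'.
have colk := stair_col gP kN'.
(* Here [i + j = (m - 1) + (n - 1)], which forces the far corner. *)
have [im jn] : (m.-1 <= (cell k).1)%N /\ (n.-1 <= (cell k).2)%N by lia.
apply: reach_step; first by rewrite /step /= M7 M2 ler_nat im.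
apply: reach_step; first by rewrite /step /= M8 M3 ler_nat jn.
exact: reach_refl.
Qed.

Lemma loop_all M : looping 0 (cell 0) M ->
  reach p (21 * s.-1) 68 M (fun pc M => pc = 93 /\ exists c, looping s.-1 c M).
Proof.
have H d : forall k M', (k + d = s.-1)%N -> (0 < d)%N -> looping k (cell k) M' ->
    reach p (21 * d) 68 M' (fun pc M => pc = 93 /\ exists c, looping s.-1 c M).
  elim: d => // d IH k M' kd _ lM'.
  have -> : (21 * d.+1 = 4 + (17 + 21 * d))%N by lia.
  apply: reach_trans (write_edge lM') _ => _ M1 [-> lM1].
  case: d IH kd => [|d] IH kd; last first.
    apply: reach_trans (next_edge _ lM1) _; first lia.
    by move=> _ M2 [-> lM2]; apply: IH lM2; lia.
  have kS : k.+1 = s.-1 by lia.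
  have -> : (17 + 21 * 0 = 2 + 15)%N by [].
  apply: reach_trans (last_edge kS lM1) _ => _ M2 [-> lM2].
  by apply: reach_refl; split=> //; exists (cell k); rewrite -kS.
by apply: H => //; lia.
Qed.

Lemma mst_program_correct :
  exists M, run p (73 * s) 0 I0 = Some M /\
    output_edges M = [seq ((cell k).1, (cell k).2) | k <- iota 0 s.-1].
Proof.
have [D15 Ds] := base_ge.
have : reach p (37 + (7 + 6 * s + (19 + 21 * s.-1))) 0 I0
    (fun pc M => pc = 93 /\ exists c, looping s.-1 c M).
  apply: reach_trans all_saved _ => _ M1 [-> sv].
  apply: reach_trans (copy_all sv) _ => _ M2 [-> [c cs cp]].
  apply: reach_trans (start_looping cs cp) _ => _ M3 [-> lp].
  exact: loop_all.
case/reach_halt=> [_ M [-> _] //|M [runM [_ [_ [c [M0 M1 _ _ _ _ _ _ _ _ _ _ out]]]]]].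
(* With the halting step the total is [43 + 27 * s], at most [73 * s]. *)
exists M; split; first by apply: run_mono runM; lia.
rewrite /output_edges M0 M1 !addr_nat; apply/eq_in_map => l.
by rewrite mem_iota => /out [-> ->]; rewrite !addr_nat.
Qed.
End Program.

(* There is a single fixed real-RAM program p and a constant c such that, for
   every input (nonempty sorted red/blue point sets on the x-axis, all points
   distinct), p halts within c * (|R| + |B|) steps and outputs an MST of G(R,B). *)
Theorem mainTheorem3 :
  exists (p : seq instr) (c : nat),
    forall (R : realType) (xr xb : seq R),
      (0 < size xr)%N -> (0 < size xb)%N ->
      sorted <%R xr -> sorted <%R xb ->
      (forall x, x \in xr -> x \notin xb) ->
      exists M : ram_mem R,
        run p (c * (size xr + size xb)) 0 (init_mem xr xb) = Some M /\
        describes_MST xr xb (output_edges M).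
Proof.
exists mst_program, 73%N => R xr xb m0 n0 sr sb _.
have gP := greedy_cellP (nth 0 xr) (nth 0 xb) m0 n0.
have [M [runM outM]] := mst_program_correct m0 n0.
exists M; split=> //; rewrite outM; split; last split; last exact: stair_MST gP.
  apply/allP => _ /mapP[k + ->] /=; rewrite mem_iota => kN.
  by rewrite (stair_row gP) ?(stair_col gP).
(* A cell determines its position as [row + col]. *)
rewrite map_inj_in_uniq ?iota_uniq // => k l; rewrite !mem_iota => kN lN [e1 e2].
by rewrite -(stair_sum gP kN) -(stair_sum gP lN) e1 e2.
Qed.
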